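(* Let $(C,\phi)$ be a multistate monotone system and $k\in\{1,\ldots,M\}$. For $\bm{y}\in\mathfrak{C}\setminus\{\bm{0}\}$ let $A(\bm{y})=\{i:y_i>0\}$, and for $B\subseteq A(\bm{y})$ define $\bm{x}(B)\in\mathfrak{C}$ by $x_i(B)=y_i$ for $i\in B$, $x_i(B)=y_i-1$ for $i\in A(\bm{y})\setminus B$, and $x_i(B)=0$ otherwise. Then $$\delta_k(\bm{y})=\sum_{B\subseteq A(\bm{y})}\phi_k(\bm{x}(B))\,(-1)^{|A(\bm{y})|-|B|}.$$
   Context: A multistate monotone system (MMS) $(C,\phi)$ has component set $C=\{1,\ldots,n\}$, component state sets $\mathcal{S}_i=\{0,1,\ldots,m_i\}$, component state space $\mathfrak{C}=\mathcal{S}_1\times\cdots\times\mathcal{S}_n$, system state set $\{0,1,\ldots,M\}$, and a structure function $\phi:\mathfrak{C}\to\{0,\ldots,M\}$ non-decreasing in each argument; $\phi_k(\bm{x})=\mathrm{I}(\phi(\bm{x})\ge k)$. Vectors are ordered componentwise. A minimal $k$-level path vector is $\bm{x}\in\mathfrak{C}$ with $\phi(\bm{x})\ge k$ and $\phi(\bm{y})<k$ for all $\bm{y}\le\bm{x}$, $\bm{y}\ne\bm{x}$; $\mathfrak{P}_k$ is the set of these, and $\mathrm{cl}(\mathfrak{P}_k)$ is the smallest set containing $\mathfrak{P}_k$ closed under componentwise maximum $\vee$. A formation of $\bm{x}\in\mathrm{cl}(\mathfrak{P}_k)$ is a nonempty subset $\{\bm{x}_{i_1},\ldots,\bm{x}_{i_j}\}\subseteq\mathfrak{P}_k$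 with $\bm{x}=\bm{x}_{i_1}\vee\cdots\vee\bm{x}_{i_j}$, odd/even according to parity of $j$. The $k$-level signed domination function is $\delta_k(\bm{x})=$ (number of odd formations) $-$ (number of even formations) for $\bm{x}\in\mathrm{cl}(\mathfrak{P}_k)$, and $\delta_k(\bm{x})=0$ for $\bm{x}\in\mathfrak{C}\setminus\mathrm{cl}(\mathfrak{P}_k)$. *)

(* Defs.v *)
From mathcomp Require Import all_boot all_order all_algebra.

Set Implicit Arguments.
Unset Strict Implicit.
Unset Printing Implicit Defensive.

Import Order.TTheory GRing.Theory Num.Theory.

(* The state space S_1 x ... x S_n with S_i = {0, ..., m_i}; the component
   set {1, ..., n} is indexed by 'I_n. *)
Notation state_space m := {dffun forall i, 'I_(m i).+1}.

Section Vectors.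
Variables (n : nat) (m : 'I_n -> nat).
Implicit Types x y : state_space m.

Definition vle x y : bool := [forall i, x i <= y i].

Definition vzero : state_space m := [ffun i => ord0 : 'I_(m i).+1].

Definition vmax x y : state_space m :=
  [ffun i => Order.max (x i) (y i) : 'I_(m i).+1].

(* [vzero] is neutral for [vmax], so this is the usual join when F is
   nonempty, which is the only case in which it is used. *)
Definition vjoin (F : {set state_space m}) : state_space m :=
  \big[vmax/vzero]_(x in F) x.

Definition max_closed (S : {set state_space m}) : bool :=
  [forall x in S, forall y in S, vmax x y \in S].

(* The smallest max-closed superset of P, as the intersection of all of them. *)
Definition cl (P : {set state_space m}) : {set state_space m} :=
  \bigcap_(S : {set state_space m} | (P \subset S) && max_closed S) S.

Definition supp y : {set 'I_n} := [set i | 0 < y i].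

(* The vector x(B) attached to y; [inord] is applied in range, since
   y i - 1 <= m i. *)
Definition lower_off y (B : {set 'I_n}) : state_space m :=
  [ffun i => (if i \in B then y i
              else if i \in supp y then inord (y i).-1 else ord0)
             : 'I_(m i).+1].

End Vectors.

Arguments vzero {n m}.

Record mms := MMS {
  ncomp : nat;
  cmax : 'I_ncomp -> nat;
  smax : nat;
  phi : state_space cmax -> 'I_smax.+1;
  phi_mono : forall (i : 'I_ncomp) (x y : state_space cmax),
    (forall j, j != i -> x j = y j) -> x i <= y i -> phi x <= phi y
}.

Section Domination.
Variables (S : mms) (k : nat).
Implicit Types x y : state_space (@cmax S).

Definition phi_level x : bool := k <= phi x.

Definition min_path x : bool :=
  (k <= phi x) && [forall y, vle y x && (y != x) ==> (phi y < k)].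

Definition min_paths : {set state_space (@cmax S)} := [set x | min_path x].

Definition formation x (F : {set state_space (@cmax S)}) : bool :=
  [&& F != set0, F \subset min_paths & vjoin F == x].

Definition signed_dom x : int :=
  if x \in cl min_paths then
    (#|[set F | formation x F & odd #|F|]|%:Z
     - #|[set F | formation x F & ~~ odd #|F|]|%:Z)%R
  else 0%R.

End Domination.

(* Main.v *)
Require Import Defs.
From mathcomp Require Import all_boot all_order all_algebra.
From mathcomp Require Import zify.

(** Minimal path vectors below [x] exist exactly when [phi x >= k], so the
    alternating sum over nonempty sets [F] of minimal path vectors whose join
    lies below [x] equals [phi_k x].  Substituting this for [phi_k (x(B))] and
    exchanging sums, the coefficient of [F] is the alternating sum over those
    [B] between [{i in A(y) | (vjoin F) i = y i}] and [A(y)], provided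
    [vjoin F <= y]; it vanishes unless [vjoin F = y]. *)

Set Implicit Arguments.
Unset Strict Implicit.
Unset Printing Implicit Defensive.

Import Order.TTheory GRing.Theory Num.Theory.

(** * Alternating sums over intervals of finite sets *)

Section Alternating.
Variable T : finType.
Implicit Types A B C : {set T}.

(** The symmetric difference of [B] with the singleton of [a]. *)
Definition toggle (a : T) B := if a \in B then B :\ a else a |: B.

Lemma in_toggle a B x : (x \in toggle a B) = (x \in B) (+) (x == a).
Proof.
rewrite /toggle; case: ifP => aB; rewrite !inE; case: eqP => [->|_];
  by rewrite ?aB ?addbF //= ?andbT ?orbF.
Qed.

Lemma toggleK a : involutive (toggle a).
Proof. by move=> B; apply/setP => x; rewrite !in_toggle -addbA addbb addbF. Qed.

Lemma sign_card_toggle a B : ((-1) ^+ #|toggle a B| = - (-1) ^+ #|B| :> int)%R.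
Proof.
rewrite /toggle; case: ifP => aB; last by rewrite cardsU1 aB exprS mulN1r.
by rewrite [#|B|](cardsD1 a) aB exprS mulN1r opprK.
Qed.

(** If [C] is not all of [A], toggling some [a] in [A] but not in [C] permutes the interval and
    reverses every sign, so the sum equals its own negative. *)
Lemma sum_sign_interval C A : C \subset A ->
  (\sum_(B : {set T} | (C \subset B) && (B \subset A)) (-1) ^+ #|B| : int)%R =
  ((C == A)%:R * (-1) ^+ #|A|)%R.
Proof.
move=> CA; case: eqVneq => [->|neCA].
  rewrite mul1r (big_pred1 A) // => B /=.
  by rewrite andbC eqEsubset.
rewrite mul0r; have /properP[_ [a aA aC]] : C \proper A by rewrite properEneq neCA.
have toggle_interval B : (C \subset toggle a B) && (toggle a B \subset A)
                       = (C \subset B) && (B \subset A).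
  congr (_ && _); apply/subsetP/subsetP => sub x.
  1,2: move=> xC; have := sub x xC; rewrite in_toggle;
       by case: eqP xC aC => [->->|]; rewrite // addbF.
  - case: (eqVneq x a) => [->//|xa] xB; apply: sub.
    by rewrite in_toggle xB (negPf xa).
  - case: (eqVneq x a) => [->//|xa]; rewrite in_toggle (negPf xa) addbF.
    exact: sub.
set s := (\sum_(_ | _) _)%R; suff : s = (- s)%R by lia.
rewrite {1}/s (reindex_inj (inv_inj (toggleK a))) /= -sumrN.
by apply: eq_big => [B|B _]; rewrite ?toggle_interval ?sign_card_toggle.
Qed.

(** Take the interval from [set0] to [A], remove the term 1 of [set0] and negate. *)
Lemma sum_sign_nonempty A :
  (\sum_(B : {set T} | (B != set0) && (B \subset A)) - (-1) ^+ #|B| : int)%R =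
  ((A != set0)%:R)%R.
Proof.
have := sum_sign_interval (sub0set A); rewrite (bigD1 set0) ?sub0set //=.
rewrite (eq_bigl (fun B : {set T} => (B != set0) && (B \subset A))); last first.
  by move=> B; rewrite sub0set andbC.
rewrite sumrN cards0 expr0 (eq_sym set0).
by case: eqVneq => [->|_] /=; rewrite ?cards0 ?expr0 ?mul0r ?mul1r;
  move/(canRL (addKr _)) => ->.
Qed.

Lemma sum_sign_codim_interval C A : C \subset A ->
  (\sum_(B : {set T} | (C \subset B) && (B \subset A))
     (-1) ^+ (#|A| - #|B|) : int)%R = ((C == A)%:R)%R.
Proof.
move=> CA; rewrite -[RHS](signrMK #|A|) mulrC [X in (X * _)%R]mulrC.
rewrite -(sum_sign_interval CA) mulr_suml; apply: eq_bigr => B /andP[_ BA].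
(* Since [B] lies in [A], the natural subtraction does not truncate, and the exponent has the parity
   of [#|A| + #|B|]. *)
by rewrite -signr_odd oddB ?subset_leq_card // signr_addb !signr_odd mulrC.
Qed.

End Alternating.

(** * Joins of state vectors and the vectors [lower_off y B] *)

Section Vectors.
Variables (n : nat) (m : 'I_n -> nat).
Implicit Types x y z : state_space m.

Lemma vleP x y : reflect (forall i, x i <= y i) (vle x y).
Proof. exact: forallP. Qed.

Lemma vle_refl x : vle x x.
Proof. exact/vleP. Qed.

Lemma vle_trans y x z : vle x y -> vle y z -> vle x z.
Proof. by move=> /vleP xy /vleP yz; apply/vleP => i; apply: leq_trans (yz i). Qed.

Lemma vle_anti x y : vle x y -> vle y x -> x = y.
Proof.
move=> /vleP xy /vleP yx; apply/ffunP => i; apply/val_inj/eqP.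
by rewrite eqn_leq xy yx.
Qed.

Lemma val_vmax x y i : vmax x y i = maxn (x i) (y i) :> nat.
Proof.
by rewrite /vmax ffunE maxEle leEord; case: leqP.
Qed.

Lemma vmax_le x y z : vle (vmax x y) z = vle x z && vle y z.
Proof.
apply/vleP/andP => [h|[/vleP xz /vleP yz] i]; last first.
  by rewrite val_vmax geq_max xz yz.
by split; apply/vleP => i; have := h i; rewrite val_vmax geq_max => /andP[].
Qed.

Lemma vzero_le x : vle vzero x.
Proof. by apply/vleP => i; rewrite ffunE. Qed.

Lemma vmax0 x : vmax x vzero = x.
Proof. by apply/ffunP => i; apply/val_inj; rewrite /= val_vmax ffunE maxn0. Qed.

Lemma vjoin_le (F : {set state_space m}) z :
  vle (vjoin F) z = (F \subset [set x | vle x z]).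
Proof.
(* The join is a fold, so the inclusion is restated on the list of members of [F] to allow
   induction. *)
have -> : (F \subset [set x | vle x z]) =
    all (fun x => vle x z) [seq x <- index_enum _ | x \in F].
  apply/subsetP/allP => h x; have := h x;
    rewrite mem_filter mem_index_enum andbT inE; exact.
rewrite /vjoin -big_filter.
elim: (filter _ _) => [|x s IH]; first by rewrite big_nil vzero_le.
by rewrite big_cons vmax_le IH.
Qed.

Lemma vjoin_in_cl (P F : {set state_space m}) :
  F != set0 -> F \subset P -> vjoin F \in cl P.
Proof.
case/set0Pn => x0 x0F /subsetP FP.
apply/bigcapP => S /andP[/subsetP PS /forall_inP maxS].
rewrite /vjoin -big_filter; set s := filter _ _.
have : s != [::].
  have : x0 \in s by rewrite mem_filter x0F mem_index_enum.
  by case: s.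
have : {subset s <= S} by move=> x; rewrite mem_filter => /andP[/FP/PS].
(* The effective base case is a one-element list, because [vzero] need not lie in [S]. *)
elim: s => // x [|x' s] IH sub _; rewrite big_cons.
  by rewrite big_nil vmax0 sub ?mem_head.
have /forall_inP := maxS x (sub x (mem_head _ _)); apply.
by apply: IH => // z zs; apply: sub; rewrite in_cons zs orbT.
Qed.

(** Positive coordinates of [y] outside [B] drop by one, so there [z i <= y i] has to be strict: [z]
    may meet [y] on its support only inside [B]. *)
Lemma le_lower_off y (B : {set 'I_n}) z :
  vle z (lower_off y B)
  = vle z y && ([set i in supp y | z i == y i] \subset B).
Proof.
(* Two branches suffice: off the support [y i] is 0, whose predecessor is again 0. *)
have lowerE i : nat_of_ord (lower_off y B i) =
    if i \in B then nat_of_ord (y i) else (y i).-1.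
  rewrite /lower_off ffunE; case: ifP => // _; case: ifP => [_|].
    by rewrite inordK //; have := ltn_ord (y i); lia.
  by rewrite inE lt0n => /negbFE/eqP->.
apply/vleP/andP => [h|[/vleP zy /subsetP tight] i].
  split; first by apply/vleP => i; have := h i; rewrite lowerE; case: ifP; lia.
  apply/subsetP => i; rewrite !inE => /andP[y0 /eqP zyi].
  by have := h i; rewrite lowerE zyi; case: ifP => //; lia.
rewrite lowerE; have := zy i; case: ifP => // /negbT iB zyi.
have := contra (tight i) iB; rewrite !inE negb_and -val_eqE /=; lia.
Qed.

Lemma sum_le_lower_off y z :
  (\sum_(B : {set 'I_n} | B \subset supp y)
     (vle z (lower_off y B))%:R * (-1) ^+ (#|supp y| - #|B|) : int)%R
  = ((z == y)%:R)%R.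
Proof.
set C := [set i in supp y | z i == y i].
have CA : C \subset supp y by apply/subsetP => i; rewrite inE => /andP[].
transitivity ((vle z y)%:R * (C == supp y)%:R : int)%R.
  rewrite -(sum_sign_codim_interval CA) mulr_sumr big_mkcond [RHS]big_mkcond /=.
  apply: eq_bigr => B _; case: ifP => BA; rewrite ?andbF // andbT le_lower_off.
  by rewrite -/C; case: (vle z y); case: (C \subset B); rewrite ?mul1r ?mul0r.
rewrite -natrM mulnb; congr (nat_of_bool _)%:R%R.
apply/andP/eqP => [[/vleP zy /eqP CE]|zy]; last first.
  by rewrite zy vle_refl; split=> //; apply/eqP/setP => i;
    rewrite !inE zy eqxx andbT.
apply/ffunP => i; case: (boolP (i \in supp y)) => [|yi0].
  by rewrite -CE inE => /andP[_ /eqP].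
(* Off the support of [y], the bound by [y] forces both coordinates to be 0. *)
apply/val_inj/eqP; move: yi0 (zy i); rewrite inE -leqNgt /=; lia.
Qed.

End Vectors.

(** * Minimal path vectors and formations *)

Section Domination.
Variables (S : mms) (k : nat).
Implicit Types x y z : state_space (@cmax S).
Implicit Types F : {set state_space (@cmax S)}.

(** [phi_mono] varies one coordinate only; the induction is on the number of coordinates where [x]
    and [y] differ, raising one of them at a time. *)
Lemma phi_vle x y : vle x y -> phi x <= phi y.
Proof.
move: {2}#|_| (erefl #|[set i | x i != y i]|) => d.
elim: d x => [|d IH] x dE /vleP xy.
  suff -> : x = y by [].
  apply/ffunP => i; apply/eqP; move/eqP: dE; rewrite cards_eq0 => /eqP/setP/(_ i).
  by rewrite !inE => /negbFE.
have /card_gt0P[i] : 0 < #|[set i | x i != y i]| by rewrite dE.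
rewrite inE => ne.
pose x' : state_space (@cmax S) := [ffun j => if j == i then y j else x j].
have x'i : x' i = y i by rewrite ffunE eqxx.
have x'j j : j != i -> x' j = x j by rewrite ffunE => /negPf->.
apply: (@leq_trans (phi x')).
  by apply: (@phi_mono S i) => [j /x'j->//|]; rewrite x'i.
apply: IH; last by apply/vleP => j; case: (eqVneq j i) => [->|/x'j->]; rewrite ?x'i.
move: dE; rewrite (cardsD1 i) inE ne => -[<-]; apply: eq_card => j.
by rewrite !inE; case: (eqVneq j i) => [->|/x'j->] //=; rewrite x'i eqxx.
Qed.

(** Among the vectors below [x] of level at least [k], one with least coordinate sum is minimal. *)
Lemma min_path_below x :
  phi_level k x -> exists2 p, p \in min_paths S k & vle p x.
Proof.
move=> xk; pose Q z := phi_level k z && vle z x.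
have Qx : Q x by rewrite /Q xk vle_refl.
case: (arg_minnP (fun z => \sum_i z i) Qx) => p /andP[pk px] pmin.
exists p => //; rewrite inE /min_path -/(phi_level k p) pk /=.
apply/forallP => z; apply/implyP => /andP[zp]; apply: contraR.
rewrite -leqNgt => zk; apply/eqP/(vle_anti zp)/vleP => i.
(* The sum of [p] is at most that of [z], while [z] is at most [p] off [i]; hence [p i <= z i]. *)
have := pmin z; rewrite /Q /phi_level zk (vle_trans zp px) => /(_ isT).
rewrite (bigD1 i) // [X in _ <= X](bigD1 i) //=.
have : \sum_(j | j != i) z j <= \sum_(j | j != i) p j.
  by apply: leq_sum => j _; apply: (vleP _ _ zp).
move=> le_rest /leq_trans le_sum; rewrite -(leq_add2r (\sum_(j | j != i) p j)).
by apply: le_sum; rewrite leq_add2l.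
Qed.

Lemma sum_sign_vjoin_le x :
  (\sum_(F | (F != set0) && (F \subset min_paths S k))
     - (-1) ^+ #|F| * (vle (vjoin F) x)%:R : int)%R = ((phi_level k x)%:R)%R.
Proof.
transitivity (((min_paths S k :&: [set z | vle z x] != set0)%:R)%R : int).
  rewrite -sum_sign_nonempty big_mkcond [RHS]big_mkcond /=; apply: eq_bigr => F _.
  rewrite vjoin_le subsetI andbA; case: (_ && (F \subset min_paths S k)) => //=.
  by case: ifP; rewrite ?mulr1 ?mulr0.
congr (nat_of_bool _)%:R%R; apply/set0Pn/idP => [[p]|/min_path_below[p pP px]].
  by rewrite !inE => /andP[/andP[pk _] /phi_vle]; exact: leq_trans.
by exists p; rewrite !inE px andbT; move: pP; rewrite inE.
Qed.

(** The sign is +1 on odd and -1 on even formations; outside the closure there are no formations, so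
    the sum is empty there. *)
Lemma signed_domE y :
  signed_dom k y = (\sum_(F | formation k y F) - (-1) ^+ #|F| : int)%R.
Proof.
rewrite /signed_dom; case: ifPn => [_|ycl]; last first.
  rewrite big_pred0 // => F; apply/negP => /and3P[F0 FP /eqP joinF].
  by rewrite -joinF vjoin_in_cl in ycl.
rewrite (bigID (fun F => odd #|F|)) /=; congr (_ + _)%R.
  under eq_bigr => F /andP[_ oF] do rewrite -signr_odd oF expr1 opprK.
  by rewrite sumr_const natz; congr (Posz _); apply: eq_card => F; rewrite inE.
under eq_bigr => F /andP[_ /negPf oF] do rewrite -signr_odd oF expr0.
rewrite sumrN sumr_const natz; congr (- Posz _)%R.
by apply: eq_card => F; rewrite inE.
Qed.

End Domination.

Theorem theorem4p2 (S : mms) (k : nat) (k_bounds : 1 <= k <= smax S)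
    (y : state_space (@cmax S)) (y_neq0 : y <> vzero) :
  signed_dom k y =
  (\sum_(B : {set 'I_(ncomp S)} | B \subset supp y)
     (phi_level k (lower_off y B))%:R * (-1) ^+ (#|supp y| - #|B|))%R.
Proof.
rewrite signed_domE.
under [RHS]eq_bigr => B _ do rewrite -sum_sign_vjoin_le mulr_suml.
rewrite exchange_big /=.
under [RHS]eq_bigr => F _.
  under eq_bigr => B _ do rewrite -mulrA.
  rewrite -mulr_sumr sum_le_lower_off; over.
(* The remaining indicator of [vjoin F == y] singles out the formations of [y] among the nonempty
   sets of minimal path vectors. *)
rewrite big_mkcond [RHS]big_mkcond /=; apply: eq_bigr => F _.
rewrite /formation andbA; case: (_ && (F \subset _)) => //=.
by case: eqP; rewrite ?mulr1 ?mulr0.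
Qed.
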